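(* Consider (A) the discrete controlled system $$\frac{\partial L^d(q_k,q_{k+1})}{\partial\phi_k}+\frac{\partial L^d(q_{k-1},q_k)}{\partial\phi_k}=0,\qquad \frac{\partial L^d(q_k,q_{k+1})}{\partial s_k}+\frac{\partial L^d(q_{k-1},q_k)}{\partial s_k}=-u_k,$$ with control input $$u_k=-\frac{\gamma\,\Delta\phi_k\,\tau(\phi_{k+1/2})-\gamma\,\Delta\phi_{k-1}\,\tau(\phi_{k-1/2})}{h},$$ and (B) the discrete Euler--Lagrange system of the discrete controlled Lagrangian $\Lambda^d_{\tau,\sigma,\lambda}$, $$\frac{\partial \Lambda^d_{\tau,\sigma,\lambda}(q_k,q_{k+1})}{\partial\phi_k}+\frac{\partial \Lambda^d_{\tau,\sigma,\lambda}(q_{k-1},q_k)}{\partial\phi_k}=0,\qquad \frac{\partial \Lambda^d_{\tau,\sigma,\lambda}(q_k,q_{k+1})}{\partial s_k}+\frac{\partial \Lambda^d_{\tau,\sigma,\lambda}(q_{k-1},q_k)}{\partial s_k}=0.$$ In both systems the second equation is equivalent to conservation of the discrete controlled momentum $p_k$. The dynamics (A) restricted to the momentum level $p_k=p$ is equivalent to the dynamics (B) restricted to the same momentum level if and only if the matching conditions $$\sigma=-\frac{1}{\gamma\kappa},\qquad \lambda=-p$$ hold.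
   Context: The configuration space is the product of a one-dimensional shape space $S$ and a one-dimensional Lie group $G$, with configuration variables $q=(\phi,s)$, $\phi\in S$, $s\in G$. The time step is $h>0$. For a sequence $q_k=(\phi_k,s_k)$ write $q_{k+1/2}=(q_k+q_{k+1})/2$ (componentwise) and $\Delta q_k=q_{k+1}-q_k$. The continuous Lagrangian is kinetic minus potential energy, $$L(\phi,\dot\phi,\dot s)=\tfrac12\big[\alpha\dot\phi^2+2\beta(\phi)\dot\phi\dot s+\gamma\dot s^2\big]-V(\phi),$$ with $\alpha,\gamma$ constants; the potential is $G$-invariant, i.e. depends only on $\phi$. The discrete Lagrangian is $$L^d(q_k,q_{k+1})=h\,L\big(\phi_{k+1/2},\Delta\phi_k/h,\Delta s_k/h\big).$$ With $\tau(\phi)=\kappa\beta(\phi)$ and real constants $\kappa,\sigma,\lambda$, the discrete controlled Lagrangian is $$\Lambda^d_{\tau,\sigma,\lambda}(q_k,q_{k+1})=h\Big[L\big(\phi_{k+1/2},\tfrac{\Delta\phi_k}{h},\tfrac{\Delta s_k}{h}+\kappa\beta(\phi_{k+1/2})\tfrac{\Delta\phi_k}{h}\big)+\tfrac{\sigma\gamma}{2}\big(\kappa\beta(\phi_{k+1/2})\tfrac{\Delta\phi_k}{h}\big)^2+\lambda\kappa\beta(\phi_{k+1/2})\tfrac{\Delta\phi_k}{h}\Big].$$ The discrete controlled momentum is $$p_k=-\frac{\partial}{\partial s_k}\Lambda^d_{\tau,\sigma,\lambda}(q_k,q_{k+1})=\frac{(1+\gamma\kappa)\beta(\phi_{k+1/2})\Delta\phi_k+\gamma\Delta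 s_k}{h}.$$ The real number $p$ is a constant momentum value. The restricted dynamics are compared after reduction: the momentum relation $p_k=p$ is solved for $\Delta s_k$ and the solution is substituted in the first equations of (A) and (B).
   Formalization: The ''only if'' is proved for β not affine on S: for affine β any λ gives the same restricted dynamics once σ=-1/(γκ). Equivalence means equal reduced equations for the given V, or equal solution sets for all potentials V. S is an open interval. *)

(* Defs.v *)
From Stdlib Require Import Reals.
From Coquelicot Require Import Coquelicot.
Open Scope R_scope.

(** Configurations q = (phi, s).  The shape space is an open interval ]a, b[
    with possibly infinite endpoints (a chart, or the universal cover of the
    circle), so that the midpoint of two shapes is a shape; the
    one-dimensional group G is written additively, in its coordinate s. *)
Definition config : Type := (R * R)%type.

Definition shape (a b : Rbar) (phi : R) : Prop :=
  Rbar_lt a phi /\ Rbar_lt phi b.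

Definition mid (x y : R) : R := (x + y) / 2.

Definition affine_on (a b : Rbar) (beta : R -> R) : Prop :=
  exists c d : R, forall phi, shape a b phi -> beta phi = c * phi + d.

Definition lagrangian (alpha gamma : R) (beta V : R -> R)
    (phi dphi ds : R) : R :=
  / 2 * (alpha * dphi ^ 2 + 2 * beta phi * dphi * ds + gamma * ds ^ 2) - V phi.

Definition discrete_lagrangian (h alpha gamma : R) (beta V : R -> R)
    (q q' : config) : R :=
  let (phi, s) := q in let (phi', s') := q' in
  h * lagrangian alpha gamma beta V
        (mid phi phi') ((phi' - phi) / h) ((s' - s) / h).

Definition tau (kappa : R) (beta : R -> R) (phi : R) : R := kappa * beta phi.

Definition controlled_lagrangian
    (h alpha gamma : R) (beta V : R -> R) (kappa sigma lambda : R)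
    (q q' : config) : R :=
  let (phi, s) := q in let (phi', s') := q' in
  let m := mid phi phi' in
  let v := (phi' - phi) / h in
  let t := tau kappa beta m * v in
  h * (lagrangian alpha gamma beta V m v ((s' - s) / h + t)
       + sigma * gamma / 2 * t ^ 2 + lambda * t).

(** Partial derivatives of a two-point function D(q, q') in the components of
    its first and of its second argument. *)
Definition D1_phi (D : config -> config -> R) (q q' : config) : R :=
  Derive (fun x => D (x, snd q) q') (fst q).
Definition D1_s (D : config -> config -> R) (q q' : config) : R :=
  Derive (fun x => D (fst q, x) q') (snd q).
Definition D2_phi (D : config -> config -> R) (q q' : config) : R :=
  Derive (fun x => D q (x, snd q')) (fst q').
Definition D2_s (D : config -> config -> R) (q q' : config) : R :=
  Derive (fun x => D q (fst q', x)) (snd q').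

(** Left-hand sides of the discrete Euler-Lagrange equations at q_k, for
    (q0, q1, q2) = (q_{k-1}, q_k, q_{k+1}). *)
Definition del_phi (D : config -> config -> R) (q0 q1 q2 : config) : R :=
  D1_phi D q1 q2 + D2_phi D q0 q1.
Definition del_s (D : config -> config -> R) (q0 q1 q2 : config) : R :=
  D1_s D q1 q2 + D2_s D q0 q1.

Definition control (h gamma : R) (beta : R -> R) (kappa : R)
    (q0 q1 q2 : config) : R :=
  - ((gamma * (fst q2 - fst q1) * tau kappa beta (mid (fst q1) (fst q2))
      - gamma * (fst q1 - fst q0) * tau kappa beta (mid (fst q0) (fst q1)))
     / h).

Definition sysA_phi h alpha gamma beta V (q0 q1 q2 : config) : Prop :=
  del_phi (discrete_lagrangian h alpha gamma beta V) q0 q1 q2 = 0.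
Definition sysA_s h alpha gamma beta V kappa (q0 q1 q2 : config) : Prop :=
  del_s (discrete_lagrangian h alpha gamma beta V) q0 q1 q2
  = - control h gamma beta kappa q0 q1 q2.

Definition sysB_phi h alpha gamma beta V kappa sigma lambda
    (q0 q1 q2 : config) : Prop :=
  del_phi (controlled_lagrangian h alpha gamma beta V kappa sigma lambda)
    q0 q1 q2 = 0.
Definition sysB_s h alpha gamma beta V kappa sigma lambda
    (q0 q1 q2 : config) : Prop :=
  del_s (controlled_lagrangian h alpha gamma beta V kappa sigma lambda)
    q0 q1 q2 = 0.

Definition momentum h alpha gamma beta V kappa sigma lambda
    (q q' : config) : R :=
  - D1_s (controlled_lagrangian h alpha gamma beta V kappa sigma lambda) q q'.

(** The increment of s obtained by solving the momentum relation p_k = p. *)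
Definition level_ds (h gamma : R) (beta : R -> R) (kappa p : R)
    (phi phi' : R) : R :=
  (h * p - (1 + gamma * kappa) * beta (mid phi phi') * (phi' - phi)) / gamma.

(** Substitution of that increment, on both sides of q_k = (phi1, s), in an
    expression E(q_{k-1}, q_k, q_{k+1}). *)
Definition reduce h gamma beta kappa p
    (E : config -> config -> config -> R) (phi0 phi1 phi2 s : R) : R :=
  E (phi0, s - level_ds h gamma beta kappa p phi0 phi1)
    (phi1, s)
    (phi2, s + level_ds h gamma beta kappa p phi1 phi2).

(** Equivalence as equations: after reduction, the first equations of the two
    systems are the same equation. *)
Definition same_reduced_equation (a b : Rbar)
    h alpha gamma beta V kappa sigma lambda p : Prop :=
  forall phi0 phi1 phi2 s : R,
    shape a b phi0 -> shape a b phi1 -> shape a b phi2 ->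
    reduce h gamma beta kappa p
      (del_phi (discrete_lagrangian h alpha gamma beta V)) phi0 phi1 phi2 s
    = reduce h gamma beta kappa p
      (del_phi (controlled_lagrangian h alpha gamma beta V kappa sigma lambda))
      phi0 phi1 phi2 s.

(** Equivalence as relations on (q_{k-1}, q_k, q_{k+1}): the two systems have
    the same solutions on the momentum level. *)
Definition same_level_solutions (a b : Rbar)
    h alpha gamma beta V kappa sigma lambda p : Prop :=
  forall q0 q1 q2 : config,
    shape a b (fst q0) -> shape a b (fst q1) -> shape a b (fst q2) ->
    momentum h alpha gamma beta V kappa sigma lambda q0 q1 = p ->
    momentum h alpha gamma beta V kappa sigma lambda q1 q2 = p ->
    (sysA_phi h alpha gamma beta V q0 q1 q2 /\
     sysA_s h alpha gamma beta V kappa q0 q1 q2) <->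
    (sysB_phi h alpha gamma beta V kappa sigma lambda q0 q1 q2 /\
     sysB_s h alpha gamma beta V kappa sigma lambda q0 q1 q2).

Definition matching (gamma kappa sigma lambda p : R) : Prop :=
  sigma = - (1 / (gamma * kappa)) /\ lambda = - p.

(* Main.v *)
(** On the level p_k = p the first equations of (A) and (B) differ by kappa
    times the discrete Euler-Lagrange expression of the function
    mu beta(m) v + nu beta(m)^2 v^2 / 2 of the midpoint m and the velocity v, with
    mu = p + lambda and nu = 1 + sigma gamma kappa, so matching (mu = nu = 0)
    suffices.  Conversely, when this expression vanishes, comparing (phi0, phi1)
    with (phi1, phi1) and exchanging the end points gives nu beta(m)^2 = 0 and
    mu (beta(m + t) - beta(m) - beta'(m) t) = 0; the latter makes beta' locally
    constant if mu <> 0.  For solution sets, a linear potential makes any given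
    triple of shapes a solution of (A), so that equality of the solution sets for
    all potentials forces equality of the equations. *)

Require Import Defs.
From Stdlib Require Import Reals Lra Classical.
From Coquelicot Require Import Coquelicot.
Open Scope R_scope.

(** * Intervals of shapes and a characterisation of affine functions *)

Lemma shape_mid (a b : Rbar) (x y : R) :
  shape a b x -> shape a b y -> shape a b (mid x y).
Proof.
unfold shape, mid; intros [ax xb] [ay yb].
destruct a as [a| |], b as [b| |]; simpl in *; lra.
Qed.

Lemma shape_locally (a b : Rbar) (x : R) :
  shape a b x -> locally x (shape a b).
Proof.
intros [ax xb]; apply filter_and.
- exact (open_Rbar_gt' x a ax).
- exact (open_Rbar_lt' x b xb).
Qed.

Lemma shape_between (a b : Rbar) (x y z : R) :
  shape a b x -> shape a b y -> Rmin x y <= z <= Rmax x y -> shape a b z.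
Proof.
unfold shape; intros [ax xb] [ay yb] [zl zr].
assert (zx : (x <= z \/ y <= z) /\ (z <= x \/ z <= y)).
{ revert zl zr; unfold Rmin, Rmax; destruct (Rle_dec x y); lra. }
destruct a as [a| |], b as [b| |]; simpl in *; lra.
Qed.

Lemma mid_sym (x y : R) : mid x y = mid y x.
Proof. unfold mid; lra. Qed.

Lemma mid_diag (x : R) : mid x x = x.
Proof. unfold mid; lra. Qed.

Lemma zero_derivative_constant (a b : Rbar) (f : R -> R) :
  (forall x, shape a b x -> is_derive f x 0) ->
  forall x y, shape a b x -> shape a b y -> f x = f y.
Proof.
intros df x y sx sy.
destruct (MVT_gen f x y (fun _ => 0)) as [c [_ e]].
- intros z [zl zr]; apply df, (shape_between a b x y); auto; split; lra.
- intros z zxy; apply continuity_pt_filterlim, @ex_derive_continuous.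
  exists 0; apply df, (shape_between a b x y); auto.
- lra.
Qed.

(** With the midpoint [m] fixed, the hypothesis makes [f] coincide with its tangent at [m] on a
    whole neighbourhood. Hence [Derive f] is locally constant, although [f] is only assumed
    differentiable once, and so constant on the interval. *)
Lemma affine_of_midpoint_tangent (a b : Rbar) (f : R -> R) :
  (forall x, shape a b x -> ex_derive f x) ->
  (forall x y, shape a b x -> shape a b y ->
     f (mid x y) + Derive f (mid x y) * ((y - x) / 2) = f y) ->
  affine_on a b f.
Proof.
intros df tangent.
assert (ddf : forall m, shape a b m -> is_derive (Derive f) m 0).
{ intros m sm.
  apply (is_derive_ext_loc (fun _ => Derive f m)).
  2: apply (is_derive_const (Derive f m)).
  destruct (shape_locally a b m sm) as [eps ball_eps].
  assert (near : forall z, Rabs (z - m) < eps ->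
            f z = f m + Derive f m * (z - m)).
  { intros z hz.
    assert (szl : shape a b z) by (apply ball_eps; exact hz).
    (* The reflection of [z] in [m] is also a shape, so [m] is a midpoint of two shapes. *)
    assert (szr : shape a b (2 * m - z)).
    { apply ball_eps; change (Rabs (2 * m - z - m) < eps).
      replace (2 * m - z - m) with (- (z - m)) by ring.
      now rewrite Rabs_Ropp. }
    assert (e := tangent _ _ szr szl).
    replace (mid (2 * m - z) z) with m in e by (unfold mid; field).
    rewrite <- e; field. }
  exists eps; intros z hz; symmetry.
  change (Rabs (z - m) < eps) in hz.
  apply is_derive_unique, (is_derive_ext_loc (fun y => f m + Derive f m * (y - m))).
  - assert (dpos : 0 < eps - Rabs (z - m)) by lra.
    exists (mkposreal _ dpos); intros y hy; symmetry; apply near.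
    change (Rabs (y - z) < eps - Rabs (z - m)) in hy.
    replace (y - m) with ((y - z) + (z - m)) by ring.
    apply Rle_lt_trans with (1 := Rabs_triang _ _); lra.
  - auto_derive; [exact I | ring]. }
(* The slope is read off at a base point; over an empty interval any coefficients serve. *)
destruct (classic (exists x0, shape a b x0)) as [[x0 sx0] | none].
- exists (Derive f x0), (f x0 - Derive f x0 * x0); intros x sx.
  assert (e : f x - Derive f x0 * x = f x0 - Derive f x0 * x0); [|lra].
  apply (zero_derivative_constant a b (fun y => f y - Derive f x0 * y)); auto.
  intros y sy.
  replace 0 with (Derive f y - Derive f x0).
  2: rewrite (zero_derivative_constant a b _ ddf y x0 sy sx0); ring.
  auto_derive; [now apply df | change (Derive (fun x => f x) y) with (Derive f y); ring].
- exists 0, 0; intros x sx; elim none; now exists x.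
Qed.

(** * Derivatives of the discrete Lagrangians and momentum conservation *)

Section DiscreteSystems.

Variables (h alpha gamma : R) (beta V : R -> R).
Hypothesis hh : 0 < h.

(** Lets every derivative of the discrete Lagrangian be read off the controlled one. *)
Lemma discrete_lagrangian_uncontrolled (q q' : config) :
  discrete_lagrangian h alpha gamma beta V q q'
  = controlled_lagrangian h alpha gamma beta V 0 0 0 q q'.
Proof.
destruct q as [x s], q' as [y s']; simpl.
unfold lagrangian, tau; field; lra.
Qed.

(** Exchanging the end points keeps the midpoint and reverses both velocities, so only the term
    linear in velocity changes sign. Derivatives in the first argument thus follow from those in the
    second. *)
Lemma controlled_lagrangian_reversal (kappa sigma lambda : R) (q q' : config) :
  controlled_lagrangian h alpha gamma beta V kappa sigma lambda q q'
  = controlled_lagrangian h alpha gamma beta V kappa sigma (- lambda) q' q.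
Proof.
destruct q as [x s], q' as [y s']; simpl.
unfold lagrangian, tau; rewrite (mid_sym y x); field; lra.
Qed.

Lemma D2_s_controlled (kappa sigma lambda : R) (q q' : config) :
  D2_s (controlled_lagrangian h alpha gamma beta V kappa sigma lambda) q q'
  = ((1 + gamma * kappa) * beta (mid (fst q) (fst q')) * (fst q' - fst q)
     + gamma * (snd q' - snd q)) / h.
Proof.
destruct q as [x s], q' as [y s']; unfold D2_s; simpl.
apply is_derive_unique; unfold lagrangian, tau.
auto_derive; [exact I | field; lra].
Qed.

Lemma D1_s_controlled (kappa sigma lambda : R) (q q' : config) :
  D1_s (controlled_lagrangian h alpha gamma beta V kappa sigma lambda) q q'
  = - (((1 + gamma * kappa) * beta (mid (fst q) (fst q')) * (fst q' - fst q)
        + gamma * (snd q' - snd q)) / h).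
Proof.
transitivity
  (D2_s (controlled_lagrangian h alpha gamma beta V kappa sigma (- lambda)) q' q).
- apply Derive_ext; intros x; apply controlled_lagrangian_reversal.
- rewrite D2_s_controlled, mid_sym; field; lra.
Qed.

(** The Lagrangian depends on [beta] only through the product [beta m * v]; [A] is the coefficient
    of half its square. The chain rule gives the derivative of this product times the factor in
    parentheses. *)
Lemma D2_phi_controlled (kappa sigma lambda : R) (q q' : config) :
  ex_derive beta (mid (fst q) (fst q')) -> ex_derive V (mid (fst q) (fst q')) ->
  D2_phi (controlled_lagrangian h alpha gamma beta V kappa sigma lambda) q q'
  = let m := mid (fst q) (fst q') in
    let v := (fst q' - fst q) / h in
    let w := (snd q' - snd q) / h in
    let A := 2 * kappa + (1 + sigma) * gamma * kappa ^ 2 in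
    alpha * v
    + (beta m + h / 2 * Derive beta m * v)
      * ((1 + gamma * kappa) * w + A * beta m * v + lambda * kappa)
    - h / 2 * Derive V m.
Proof.
destruct q as [x s], q' as [y s']; unfold D2_phi; simpl; intros db dV.
apply is_derive_unique; unfold lagrangian, tau, mid in *.
auto_derive; [repeat split; assumption|].
change (fun x0 : R => beta x0) with beta; change (fun x0 : R => V x0) with V.
unfold Rdiv; field; lra.
Qed.

Lemma D1_phi_controlled (kappa sigma lambda : R) (q q' : config) :
  D1_phi (controlled_lagrangian h alpha gamma beta V kappa sigma lambda) q q'
  = D2_phi (controlled_lagrangian h alpha gamma beta V kappa sigma (- lambda)) q' q.
Proof. apply Derive_ext; intros x; apply controlled_lagrangian_reversal. Qed.

Lemma del_phi_uncontrolled (q0 q1 q2 : config) :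
  del_phi (discrete_lagrangian h alpha gamma beta V) q0 q1 q2
  = del_phi (controlled_lagrangian h alpha gamma beta V 0 0 0) q0 q1 q2.
Proof.
unfold del_phi; apply f_equal2; apply Derive_ext; intros x;
  apply discrete_lagrangian_uncontrolled.
Qed.

Lemma del_s_uncontrolled (q0 q1 q2 : config) :
  del_s (discrete_lagrangian h alpha gamma beta V) q0 q1 q2
  = del_s (controlled_lagrangian h alpha gamma beta V 0 0 0) q0 q1 q2.
Proof.
unfold del_s; apply f_equal2; apply Derive_ext; intros x;
  apply discrete_lagrangian_uncontrolled.
Qed.

Lemma momentum_formula (kappa sigma lambda : R) (q q' : config) :
  momentum h alpha gamma beta V kappa sigma lambda q q'
  = ((1 + gamma * kappa) * beta (mid (fst q) (fst q')) * (fst q' - fst q)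
     + gamma * (snd q' - snd q)) / h.
Proof. unfold momentum; rewrite D1_s_controlled; ring. Qed.

Lemma momentum_level (kappa sigma lambda p : R) (q q' : config) :
  gamma <> 0 ->
  momentum h alpha gamma beta V kappa sigma lambda q q' = p <->
  snd q' - snd q = level_ds h gamma beta kappa p (fst q) (fst q').
Proof.
intros hgamma; rewrite momentum_formula; unfold level_ds; split.
- intros <-; field; lra.
- intros ->; field; lra.
Qed.

(** The control supplies exactly the [gamma * kappa * beta] terms by which the controlled momentum
    exceeds the uncontrolled one; [sigma] and [lambda] do not enter the momentum. *)
Lemma sysA_s_momentum (kappa sigma lambda : R) (q0 q1 q2 : config) :
  sysA_s h alpha gamma beta V kappa q0 q1 q2 <->
  momentum h alpha gamma beta V kappa sigma lambda q1 q2
  = momentum h alpha gamma beta V kappa sigma lambda q0 q1.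
Proof.
unfold sysA_s; rewrite del_s_uncontrolled; unfold del_s.
rewrite D1_s_controlled, D2_s_controlled, !momentum_formula.
unfold control, tau, Rdiv; split; intros e; ring_simplify; ring_simplify in e; lra.
Qed.

Lemma sysB_s_momentum (kappa sigma lambda : R) (q0 q1 q2 : config) :
  sysB_s h alpha gamma beta V kappa sigma lambda q0 q1 q2 <->
  momentum h alpha gamma beta V kappa sigma lambda q1 q2
  = momentum h alpha gamma beta V kappa sigma lambda q0 q1.
Proof.
unfold sysB_s, del_s, momentum.
rewrite !D1_s_controlled, D2_s_controlled; split; lra.
Qed.

End DiscreteSystems.

(** * Difference of the first equations on a momentum level *)

(** The derivative in y of h (mu beta(m) v + nu beta(m)^2 v^2 / 2), where
    m = (x + y) / 2 and v = (y - x) / h; exchanging x and y and replacing mu by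
    - mu gives the derivative in x. *)
Definition mismatch (h mu nu : R) (beta : R -> R) (x y : R) : R :=
  let m := mid x y in
  (beta m + Derive beta m * ((y - x) / 2)) * (mu + nu * beta m * ((y - x) / h)).

(** The terms in [alpha] and [V] cancel. On the level, [gamma * w = p - (1 + gamma * kappa) * beta m
    * v], which turns the remaining factor [gamma * kappa * w + A * beta m * v + lambda * kappa]
    into [kappa] times the second factor of [mismatch]. *)
Lemma del_phi_level_mismatch (h alpha gamma kappa sigma lambda p : R)
    (beta V : R -> R) (q0 q1 q2 : config) :
  0 < h -> gamma <> 0 ->
  ex_derive beta (mid (fst q0) (fst q1)) -> ex_derive V (mid (fst q0) (fst q1)) ->
  ex_derive beta (mid (fst q1) (fst q2)) -> ex_derive V (mid (fst q1) (fst q2)) ->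
  snd q1 - snd q0 = level_ds h gamma beta kappa p (fst q0) (fst q1) ->
  snd q2 - snd q1 = level_ds h gamma beta kappa p (fst q1) (fst q2) ->
  del_phi (controlled_lagrangian h alpha gamma beta V kappa sigma lambda) q0 q1 q2
  - del_phi (discrete_lagrangian h alpha gamma beta V) q0 q1 q2
  = kappa *
    (mismatch h (- (p + lambda)) (1 + sigma * gamma * kappa) beta (fst q2) (fst q1)
     + mismatch h (p + lambda) (1 + sigma * gamma * kappa) beta (fst q0) (fst q1)).
Proof.
intros hh hgamma b01 V01 b12 V12 s01 s12.
rewrite del_phi_uncontrolled by assumption; unfold del_phi.
rewrite !D1_phi_controlled by assumption.
rewrite (mid_sym (fst q1)) in b12, V12.
rewrite !D2_phi_controlled by assumption; cbv zeta.
replace (snd q1 - snd q2) with (- (snd q2 - snd q1)) by ring.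
rewrite s01, s12; unfold level_ds, mismatch; cbv zeta.
rewrite (mid_sym (fst q1) (fst q2)); field; lra.
Qed.

Lemma mismatch_vanishes_matching (a b : Rbar) (h mu nu : R) (beta : R -> R) :
  0 < h ->
  (forall x, shape a b x -> ex_derive beta x) ->
  ~ affine_on a b beta ->
  (forall x0 x1 x2, shape a b x0 -> shape a b x1 -> shape a b x2 ->
     mismatch h (- mu) nu beta x2 x1 + mismatch h mu nu beta x0 x1 = 0) ->
  mu = 0 /\ nu = 0.
Proof.
intros hh dbeta naff vanish.
assert (diag : forall c x, mismatch h c nu beta x x = c * beta x).
{ intros c x; unfold mismatch; cbv zeta; rewrite mid_diag; field; lra. }
(* Letting one outer point coincide with the middle one evaluates its term by [diag] and isolates
   the other. *)
assert (second : forall x y, shape a b x -> shape a b y ->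
          mismatch h mu nu beta x y = mu * beta y).
{ intros x y sx sy; generalize (vanish x y y sx sy sy); rewrite diag; lra. }
assert (first : forall x y, shape a b x -> shape a b y ->
          mismatch h (- mu) nu beta x y = - mu * beta y).
{ intros x y sx sy; generalize (vanish y y x sy sy sx); rewrite diag; lra. }
assert (nu0 : nu = 0).
{ destruct (Req_dec nu 0) as [|nu_neq0]; [assumption|].
  (* If [nu] is nonzero, [beta] vanishes at every shape [m], hence is affine. *)
  elim naff; exists 0, 0; intros m sm.
  destruct (shape_locally a b m sm) as [eps ball_eps].
  assert (eps_pos := cond_pos eps).
  assert (sl : shape a b (m - eps / 2)).
  { apply ball_eps; change (Rabs (m - eps / 2 - m) < eps); apply Rabs_def1; lra. }
  assert (sr : shape a b (m + eps / 2)).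
  { apply ball_eps; change (Rabs (m + eps / 2 - m) < eps); apply Rabs_def1; lra. }
  assert (f1 := first _ _ sl sr); assert (f2 := first _ _ sr sl).
  assert (s1 := second _ _ sl sr); assert (s2 := second _ _ sr sl).
  unfold mismatch in f1, f2, s1, s2; cbv zeta in f1, f2, s1, s2.
  rewrite (mid_sym (m + eps / 2)) in f2, s2.
  replace (mid (m - eps / 2) (m + eps / 2)) with m in f1, f2, s1, s2
    by (unfold mid; field).
  assert (e : nu * (beta m * beta m) * (eps / h) = 0).
  (* Summing over both signs of [mu] and both orientations of the segment, with signs, cancels [mu]
     and [Derive beta m] and leaves the [nu] term. *)
  { transitivity
      (/ 4 * ((beta m + Derive beta m * ((m + eps / 2 - (m - eps / 2)) / 2))
          * (mu + nu * beta m * ((m + eps / 2 - (m - eps / 2)) / h))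
        + (beta m + Derive beta m * ((m + eps / 2 - (m - eps / 2)) / 2))
          * (- mu + nu * beta m * ((m + eps / 2 - (m - eps / 2)) / h))
        - (beta m + Derive beta m * ((m - eps / 2 - (m + eps / 2)) / 2))
          * (mu + nu * beta m * ((m - eps / 2 - (m + eps / 2)) / h))
        - (beta m + Derive beta m * ((m - eps / 2 - (m + eps / 2)) / 2))
          * (- mu + nu * beta m * ((m - eps / 2 - (m + eps / 2)) / h)))).
    - field; lra.
    - rewrite f1, f2, s1, s2; ring. }
  assert (eps / h <> 0) by (apply Rgt_not_eq, Rdiv_lt_0_compat; lra).
  apply Rmult_integral in e; destruct e as [e|e]; [|easy].
  apply Rmult_integral in e; destruct e as [e|e]; [easy|].
  apply Rmult_integral in e; lra. }
split; [|assumption].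
destruct (Req_dec mu 0) as [|mu_neq0]; [assumption|].
elim naff; apply affine_of_midpoint_tangent; [assumption|].
(* Once [nu] is zero, [second] is the midpoint tangent identity multiplied by [mu]. *)
intros x y sx sy; apply Rmult_eq_reg_l with mu; [|assumption].
rewrite <- second with (x := x) by assumption.
unfold mismatch; cbv zeta; rewrite nu0; ring.
Qed.

(** * Momentum conservation and matching *)

Theorem theorem2
  (a b : Rbar) (h alpha gamma kappa sigma lambda p : R) (beta V : R -> R)
  (hab : Rbar_lt a b) (hh : 0 < h) (hgamma : gamma <> 0) (hkappa : kappa <> 0)
  (hbeta : forall phi, shape a b phi -> ex_derive beta phi)
  (hV : forall phi, shape a b phi -> ex_derive V phi) :
  (* the displayed formula for the momentum, and its solution for Delta s_k *)
  (forall q q' : config, shape a b (fst q) -> shape a b (fst q') ->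
     momentum h alpha gamma beta V kappa sigma lambda q q'
     = ((1 + gamma * kappa) * beta (mid (fst q) (fst q')) * (fst q' - fst q)
        + gamma * (snd q' - snd q)) / h
     /\ (momentum h alpha gamma beta V kappa sigma lambda q q' = p <->
         snd q' - snd q = level_ds h gamma beta kappa p (fst q) (fst q')))
  (* in (A) and in (B), the second equation is momentum conservation *)
  /\ (forall q0 q1 q2 : config,
        shape a b (fst q0) -> shape a b (fst q1) -> shape a b (fst q2) ->
        (sysA_s h alpha gamma beta V kappa q0 q1 q2 <->
         momentum h alpha gamma beta V kappa sigma lambda q1 q2
         = momentum h alpha gamma beta V kappa sigma lambda q0 q1)
        /\
        (sysB_s h alpha gamma beta V kappa sigma lambda q0 q1 q2 <->
         momentum h alpha gamma beta V kappa sigma lambda q1 q2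
         = momentum h alpha gamma beta V kappa sigma lambda q0 q1))
  (* sufficiency of matching, without genericity of beta *)
  /\ (matching gamma kappa sigma lambda p ->
        same_reduced_equation a b h alpha gamma beta V kappa sigma lambda p
        /\ same_level_solutions a b h alpha gamma beta V kappa sigma lambda p)
  (* equivalence of the restricted dynamics if and only if matching *)
  /\ (~ affine_on a b beta ->
        (same_reduced_equation a b h alpha gamma beta V kappa sigma lambda p
           <-> matching gamma kappa sigma lambda p)
        /\
        ((forall W : R -> R,
            (forall phi, shape a b phi -> ex_derive W phi) ->
            same_level_solutions a b h alpha gamma beta W kappa sigma lambda p)
           <-> matching gamma kappa sigma lambda p)).
Proof.
assert (dmid : forall f : R -> R, (forall x, shape a b x -> ex_derive f x) ->
          forall x y, shape a b x -> shape a b y -> ex_derive f (mid x y)).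
{ intros f df x y sx sy; apply df; now apply shape_mid. }
assert (gap : forall (W : R -> R) (q0 q1 q2 : config),
  (forall phi, shape a b phi -> ex_derive W phi) ->
  shape a b (fst q0) -> shape a b (fst q1) -> shape a b (fst q2) ->
  snd q1 - snd q0 = level_ds h gamma beta kappa p (fst q0) (fst q1) ->
  snd q2 - snd q1 = level_ds h gamma beta kappa p (fst q1) (fst q2) ->
  del_phi (controlled_lagrangian h alpha gamma beta W kappa sigma lambda) q0 q1 q2
  - del_phi (discrete_lagrangian h alpha gamma beta W) q0 q1 q2
  = kappa *
    (mismatch h (- (p + lambda)) (1 + sigma * gamma * kappa) beta (fst q2) (fst q1)
     + mismatch h (p + lambda) (1 + sigma * gamma * kappa) beta (fst q0) (fst q1))).
{ intros W q0 q1 q2 dW s0 s1 s2 l01 l12.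
  apply del_phi_level_mismatch; auto. }
assert (sufficient : matching gamma kappa sigma lambda p ->
  forall W : R -> R, (forall phi, shape a b phi -> ex_derive W phi) ->
  same_reduced_equation a b h alpha gamma beta W kappa sigma lambda p
  /\ same_level_solutions a b h alpha gamma beta W kappa sigma lambda p).
{ intros [esigma elambda] W dW.
  assert (mu0 : p + lambda = 0) by (rewrite elambda; ring).
  assert (nu0 : 1 + sigma * gamma * kappa = 0) by (rewrite esigma; field; auto).
  rewrite mu0, nu0 in gap.
  assert (null : forall x y, mismatch h 0 0 beta x y = 0).
  { intros x y; unfold mismatch; cbv zeta; ring. }
  rewrite Ropp_0 in gap.
  split.
  - intros phi0 phi1 phi2 s s0 s1 s2; unfold reduce; symmetry.
    apply Rminus_diag_uniq; rewrite gap by (simpl; auto; ring).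
    rewrite !null; ring.
  - intros q0 q1 q2 s0 s1 s2 p01 p12.
    apply momentum_level in p01; [|assumption..].
    apply momentum_level in p12; [|assumption..].
    assert (e := gap W q0 q1 q2 dW s0 s1 s2 p01 p12); rewrite !null in e.
    (* Both second equations become the same conservation law and both first equations have equal
       left-hand sides. *)
    unfold sysA_phi, sysB_phi.
    rewrite sysA_s_momentum with (sigma := sigma) (lambda := lambda) by assumption.
    rewrite sysB_s_momentum by assumption.
    replace (del_phi (controlled_lagrangian h alpha gamma beta W kappa sigma lambda)
               q0 q1 q2)
      with (del_phi (discrete_lagrangian h alpha gamma beta W) q0 q1 q2) by lra.
    reflexivity. }
assert (necessary : ~ affine_on a b beta ->
  (forall x0 x1 x2, shape a b x0 -> shape a b x1 -> shape a b x2 ->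
     kappa *
     (mismatch h (- (p + lambda)) (1 + sigma * gamma * kappa) beta x2 x1
      + mismatch h (p + lambda) (1 + sigma * gamma * kappa) beta x0 x1) = 0) ->
  matching gamma kappa sigma lambda p).
{ intros naff vanish.
  destruct (mismatch_vanishes_matching a b h (p + lambda)
              (1 + sigma * gamma * kappa) beta) as [mu0 nu0]; auto.
  - intros x0 x1 x2 s0 s1 s2.
    destruct (Rmult_integral _ _ (vanish x0 x1 x2 s0 s1 s2)); easy.
  - split; [|lra].
    apply Rmult_eq_reg_r with (gamma * kappa).
    + replace (- (1 / (gamma * kappa)) * (gamma * kappa)) with (- 1)
        by (field; auto); lra.
    + now apply Rmult_integral_contrapositive_currified. }
split; [|split; [|split]].
- intros q q' _ _; split.
  + now apply momentum_formula.
  + now apply momentum_level.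
- intros q0 q1 q2 _ _ _; split.
  + now apply sysA_s_momentum.
  + now apply sysB_s_momentum.
- intros match_; now apply sufficient.
- intros naff; split; split.
  + intros same; apply necessary; [assumption|]; intros x0 x1 x2 s0 s1 s2.
    assert (e := same x0 x1 x2 0 s0 s1 s2); unfold reduce in e.
    eapply eq_trans;
      [symmetry; apply (gap V
         (x0, 0 - level_ds h gamma beta kappa p x0 x1) (x1, 0)
         (x2, 0 + level_ds h gamma beta kappa p x1 x2)); simpl; auto; ring |].
    apply Rminus_diag_eq; now symmetry.
  + intros match_; now apply sufficient.
  + intros same; apply necessary; [assumption|]; intros x0 x1 x2 s0 s1 s2.
    set (q0 := (x0, - level_ds h gamma beta kappa p x0 x1)).
    set (q1 := (x1, 0)).
    set (q2 := (x2, level_ds h gamma beta kappa p x1 x2)).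
    assert (l01 : snd q1 - snd q0
                  = level_ds h gamma beta kappa p (fst q0) (fst q1)) by (simpl; ring).
    assert (l12 : snd q2 - snd q1
                  = level_ds h gamma beta kappa p (fst q1) (fst q2)) by (simpl; ring).
    (* A potential of slope [c] contributes [- h / 2 * c] on each of the two segments; this [c]
       balances the potential-free expression, so the triple solves (A). *)
    set (c := del_phi (discrete_lagrangian h alpha gamma beta (fun _ => 0)) q0 q1 q2
              / h).
    set (W := fun x : R => c * x).
    assert (dW : forall x, is_derive W x c).
    { intros x; unfold W; auto_derive; [exact I | ring]. }
    assert (exW : forall x, shape a b x -> ex_derive W x).
    { intros x _; exists c; apply dW. }
    assert (A_phi : sysA_phi h alpha gamma beta W q0 q1 q2).
    { unfold sysA_phi.
      transitivity (del_phi (discrete_lagrangian h alpha gamma beta (fun _ => 0))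
                      q0 q1 q2 - h * c); [|unfold c; field; lra].
      rewrite !del_phi_uncontrolled by assumption; unfold del_phi.
      rewrite !D1_phi_controlled by assumption.
      rewrite !D2_phi_controlled
        by (simpl; auto using ex_derive_const); cbv zeta.
      rewrite !Derive_const, !(is_derive_unique _ _ _ (dW _)); field; lra. }
    assert (p01 := proj2 (momentum_level h alpha gamma beta W hh
                     kappa sigma lambda p q0 q1 hgamma) l01).
    assert (p12 := proj2 (momentum_level h alpha gamma beta W hh
                     kappa sigma lambda p q1 q2 hgamma) l12).
    destruct (proj1 (same W exW q0 q1 q2 s0 s1 s2 p01 p12)) as [B_phi _].
    { split; [assumption|].
      apply sysA_s_momentum with sigma lambda; [assumption|].
      now rewrite p01. }
    (* Both first equations now hold at the triple, and the right-hand side of [gap] does not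
       involve the potential. *)
    unfold sysA_phi in A_phi; unfold sysB_phi in B_phi.
    eapply eq_trans; [symmetry; apply (gap W q0 q1 q2); assumption |].
    rewrite A_phi, B_phi; ring.
  + intros match_ W dW; now apply sufficient.
Qed.
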